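(* Let $k$ be an algebraically closed field of characteristic $p>0$. The precise list of all rational numbers that can and do occur as the $F$-pure threshold of a reduced homogeneous polynomial of degree $6$ in $k[x,y]$ is: (a) if $p=3$: $\frac13$; (b) if $p\equiv 1\pmod 3$: $\frac13$ and $\frac{p-1}{3p}$; (c) if $p\equiv 2\pmod 3$: $\frac13$, $\frac{p-2}{3p}$, and $\frac{p^2-1}{3p^2}$ for $p\geq 5$, but only $\frac13$ and $\frac14$ if $p=2$.
   Context: A nonzero homogeneous polynomial is reduced if it has no repeated irreducible factors. For a nonzero homogeneous $f\in k[x,y]$ of positive degree, $\mathrm{fpt}(f)=\sup\{N/p^e : f^N\notin (x^{p^e},y^{p^e})\}=\inf\{N/p^e: f^N\in(x^{p^e},y^{p^e})\}$. *)

(* Defs.v *)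
From HB Require Import structures.
From mathcomp Require Import all_boot all_order all_algebra.
From mathcomp Require Import mpoly.
From mathcomp Require Import classical_sets reals.

Set Implicit Arguments.
Unset Strict Implicit.
Unset Printing Implicit Defensive.

Import GRing.Theory.

Local Open Scope ring_scope.

Definition divides (A : idomainType) (g f : A) : Prop := exists h : A, f = h * g.

Definition irreducible_elt (A : idomainType) (g : A) : Prop :=
  [/\ g != 0, g \isn't a GRing.unit
    & forall a b : A, g = a * b -> a \is a GRing.unit \/ b \is a GRing.unit].

Definition reduced (A : idomainType) (f : A) : Prop :=
  forall g : A, irreducible_elt g -> ~ divides (g ^+ 2) f.

Section BinaryForms.
Variable k : fieldType.

(* The variables x and y are 'X_0 and 'X_1. *)

Definition reduced_form (d : nat) (f : {mpoly k[2]}) : Prop :=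
  [/\ f != 0, f \is d.-homog & reduced f].

Definition in_ideal_xy_pow (q : nat) (g : {mpoly k[2]}) : Prop :=
  exists a b : {mpoly k[2]}, g = a * 'X_0 ^+ q + b * 'X_1 ^+ q.

(* For f nonzero, homogeneous and of positive degree, the set below contains 0
   and is bounded above by 1, so the total operator sup is the true supremum. *)
Definition fpt (R : realType) (p : nat) (f : {mpoly k[2]}) : R :=
  sup [set c : R | exists N e : nat,
         c = N%:R / p%:R ^+ e /\ ~ in_ideal_xy_pow (p ^ e) (f ^+ N)]%classic.

Definition fpt_values (R : realType) (p d : nat) : set R :=
  [set fpt R p f | f in reduced_form d]%classic.

End BinaryForms.

Arguments fpt_values k R p d : clear implicits.

(* Main.v *)
(* Write a form of degree 6 as [phi = f(t, 1)].  If [q = p^e], [p] does not divide [n] and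
   [f^n] lies in [m^[q] = (x^q, y^q)], then applying derivations shows that [m^[q]] also
   contains [f^(n-1)] times the Jacobian ideal, which contains all forms of degree 10 since
   [f] is reduced; by the socle degree of [m^[q]], either [f^(n-1)] is in [m^[q]] or
   [q <= 3 n + 2].  So once [n / q <= 1/3] is attained with [f^n] in and [f^(n-1)] outside
   [m^[q]], it is the threshold, and only [q <= p^2] matters.  If instead [f^n] is outside
   [m^[q]] for [n = (q - 1) / 3], then it is a socle generator and its Frobenius powers show
   that the threshold is [1/3].  The values are realized by [x^6 + y^6], [x^6 + x y^5] and
   [b x^6 + x^3 y^3 + b y^6], except [(p^2 - 1) / (3 p^2)], which is found on a curve of
   nearby deformations of [x^6 + y^6]. *)

Require Import Defs.
From HB Require Import structures.
From mathcomp Require Import all_boot all_order all_algebra.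
From mathcomp Require Import mpoly.
From mathcomp Require Import boolp classical_sets reals.
From mathcomp Require Import zify ring.

Set Implicit Arguments.
Unset Strict Implicit.
Unset Printing Implicit Defensive.

Import Order.TTheory GRing.Theory Num.Theory.

Local Open Scope ring_scope.

(** * Frobenius powers in one variable *)

Section FrobeniusPower.
Variables (R : comNzRingType) (p : nat).
Hypothesis pcharR : p \in [pchar R].
Implicit Types (g h : {poly R}) (q e n i : nat).

Lemma natr_pchar_expn e : (0 < e)%N -> (p ^ e)%:R = 0 :> R.
Proof. by case: e => // e _; rewrite expnS natrM (pcharf0 pcharR) mul0r. Qed.

Lemma pcharf_expn_gt0 e : (0 < p ^ e)%N.
Proof. by rewrite expn_gt0 prime_gt0 // (pcharf_prime pcharR). Qed.

Lemma exprD_frob e g h : (g + h) ^+ (p ^ e) = g ^+ (p ^ e) + h ^+ (p ^ e).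
Proof.
rewrite exprDn_pchar // pnatX; apply/orP; left.
by rewrite pnatE ?(pcharf_prime pcharR) // pchar_poly.
Qed.

Lemma poly_frobE e g :
  g ^+ (p ^ e) = (map_poly (fun c => c ^+ (p ^ e)) g) \Po 'X^(p ^ e).
Proof.
have q0 := pcharf_expn_gt0 e.
have f0 : (0 : R) ^+ (p ^ e) = 0 by rewrite expr0n; case: (p ^ e)%N q0.
elim/poly_ind: g => [|g c IH].
  by rewrite expr0n -[_ == _]negbK -lt0n q0 map_polyE polyseq0 comp_poly0.
apply/polyP=> i; rewrite exprD_frob exprMn IH -polyC_exp.
rewrite coefD coefMXn !coef_comp_poly_Xn // !coef_map_id0 // coefD coefMX coefC.
rewrite coefC; case: ltnP => [lt_iq | le_qi].
  rewrite add0r; case: (posnP i) => [-> | i0].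
    by rewrite dvdn0 div0n /= add0r.
  by rewrite gtnNdvd // -lt0n i0.
have -> : (i == 0)%N = false by lia.
have -> : (i %/ p ^ e)%N = ((i - p ^ e) %/ p ^ e).+1.
  by rewrite -{1}(subnK le_qi) divnDr // divnn q0 addn1.
have -> : (p ^ e %| i)%N = (p ^ e %| i - p ^ e)%N.
  by rewrite -{1}(subnK le_qi) dvdn_addl.
by rewrite /= !addr0.
Qed.

Lemma coef_frob e g i :
  (g ^+ (p ^ e))`_i = if (p ^ e %| i)%N then g`_(i %/ p ^ e) ^+ (p ^ e) else 0.
Proof.
have q0 := pcharf_expn_gt0 e.
rewrite poly_frobE coef_comp_poly_Xn // coef_map_id0 //.
by rewrite expr0n; case: (p ^ e)%N q0.
Qed.

(** The power [g ^+ (p ^ e)] lives in degrees divisible by [p ^ e]; this lets coefficients of large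
    powers be computed from the base [p] digits of the exponent. *)
Lemma coef_frobM e g h n d : (size g <= d)%N ->
  (g ^+ (p ^ e) * h)`_n =
    \sum_(j < d | (p ^ e * j <= n)%N) g`_j ^+ (p ^ e) * h`_(n - p ^ e * j).
Proof.
move=> sg; have q0 := pcharf_expn_gt0 e.
have -> : g ^+ (p ^ e) = \sum_(j < d) (g`_j ^+ (p ^ e))%:P * 'X^(p ^ e * j).
  apply/polyP=> i; rewrite coef_frob coef_sum.
  case: ifP => [/dvdnP [j ->] | ndv].
    rewrite mulnK //; case: (ltnP j d) => [lt_jd | le_dj].
      rewrite (bigD1 (Ordinal lt_jd)) //= coefCM coefXn mulnC eqxx mulr1.
      rewrite big1 ?addr0 // => j' ne; rewrite coefCM coefXn eqn_pmul2l //.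
      case: eqP => [ej|]; last by rewrite mulr0.
      by case/eqP: ne; apply: val_inj.
    rewrite big1 => [|j' _]; last first.
      rewrite coefCM coefXn mulnC eqn_pmul2l //.
      by have := ltn_ord j'; case: eqP => [|_ _]; [lia | rewrite mulr0].
    rewrite nth_default ?(leq_trans sg) //.
    by rewrite expr0n; case: (p ^ e)%N q0.
  rewrite big1 // => j _; rewrite coefCM coefXn.
  by case: eqP ndv => [-> | _ _]; rewrite ?dvdn_mulr ?mulr0.
rewrite mulr_suml coef_sum [RHS]big_mkcond; apply: eq_bigr => j _ /=.
by rewrite -mulrA coefCM coefXnM; case: ltnP => _; rewrite ?mulr0.
Qed.

End FrobeniusPower.

(* [frob_ideal d q g] says that the binary form of degree [d] with dehomogenization
   [g], i.e. the sum of the [g_i x^i y^(d-i)], lies in [(x^q, y^q)]. *)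
Definition frob_ideal (R : nzRingType) (d q : nat) (g : {poly R}) : Prop :=
  forall i, (i < q)%N -> (d < q + i)%N -> g`_i = 0.

(** * Operations on forms in the ideal [(x^q, y^q)] *)

Section FrobIdeal.
Variable R : comNzRingType.
Implicit Types (g h u v : {poly R}) (d n q e : nat).

Lemma size_exp_bound d n g : (size g <= d.+1)%N -> (size (g ^+ n) <= (d * n).+1)%N.
Proof.
move=> sg; rewrite (leq_trans (size_poly_exp_leq _ _)) // ltnS leq_mul2r.
by rewrite -subn1 leq_subLR add1n sg orbT.
Qed.

Lemma frob_idealD d q g h :
  frob_ideal d q g -> frob_ideal d q h -> frob_ideal d q (g + h).
Proof. by move=> Ig Ih i iq di; rewrite coefD Ig // Ih // addr0. Qed.

Lemma frob_idealM d q e g u :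
  (size u <= e.+1)%N -> frob_ideal d q g -> frob_ideal (d + e) q (u * g).
Proof.
move=> su Ig i iq di; rewrite coefM big1 // => j _.
case: (ltnP j e.+1) => [je | ej].
  by rewrite Ig ?mulr0 //; have := ltn_ord j; lia.
by rewrite nth_default ?mul0r // (leq_trans su).
Qed.

Lemma frob_ideal_large d q g : (2 * q <= d + 1)%N -> frob_ideal d q g.
Proof. by move=> le_qd i iq di; lia. Qed.

(* The socle of [k[x,y]/(x^q,y^q)] sits in degree [2q-2]: an element of degree [d]
   outside the ideal has a nonzero multiple there. *)
Lemma frob_ideal_colon d q s g : (d + s + 2 <= 2 * q)%N ->
  (forall j, (j <= s)%N -> frob_ideal (d + s) q ('X^j * g)) -> frob_ideal d q g.
Proof.
move=> le_q Is i iq di.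
(* The shift moves index [i] up to [q - 1], or by all of [s] if that is less; both land in the range
   controlled by [Is]. *)
have js : (minn s (q - 1 - i) <= s)%N by rewrite geq_minl.
have := Is _ js (i + minn s (q - 1 - i))%N.
rewrite coefXnM addnK [X in if X then _ else _]ltnNge leq_addl; apply; lia.
Qed.

End FrobIdeal.

Section FrobIdealField.
Variables (k : fieldType) (p : nat).
Hypothesis pchark : p \in [pchar k].
Implicit Types (f g h u v : {poly k}) (d q e : nat).

(** Frobenius is injective on [k] and stretches exponents by [p ^ e], so nonmembership is preserved
    as well as membership. *)
Lemma frob_ideal_frob d q e g :
  frob_ideal (d * p ^ e) (q * p ^ e) (g ^+ (p ^ e)) <-> frob_ideal d q g.
Proof.
have q0 := pcharf_expn_gt0 pchark e; split=> I i iq di.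
  have := I (i * p ^ e)%N; rewrite -mulnDl !ltn_pmul2r // coef_frob //.
  rewrite dvdn_mull // mulnK // => /(_ iq di) /eqP.
  by rewrite expf_eq0 q0 => /eqP.
rewrite coef_frob //; case: ifP => // /dvdnP [j def_i]; move: iq di.
rewrite def_i -mulnDl !ltn_pmul2r // mulnK // => jq dj.
by rewrite I // expr0n; case: (p ^ e)%N q0.
Qed.

End FrobIdealField.

(** * Derivations of forms and coprime pairs *)

Section FormDeriv.
Variable k : fieldType.
Implicit Types (c : k) (f g h u v : {poly k}) (d q : nat).

(* The derivation [c d/dx + d/dy] on forms of degree [d], in the chart [y = 1]. *)
Definition form_deriv d c g := (c%:P - 'X) * g^`() + d%:R *: g.

Lemma coef_form_deriv d c g i :
  (form_deriv d c g)`_i = c * i.+1%:R * g`_i.+1 + (d%:R - i%:R) * g`_i.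
Proof.
rewrite coefD coefZ mulrBl coefB coefCM coefXM coef_deriv mulrBl.
rewrite -mulr_natl; case: i => [|i] /=; first by ring.
by rewrite coef_deriv -[g`_i.+1 *+ _]mulr_natl; ring.
Qed.

Lemma frob_ideal_deriv d q c g : (0 < d)%N -> q%:R = 0 :> k ->
  frob_ideal d q g -> frob_ideal d.-1 q (form_deriv d c g).
Proof.
move=> d0 q0 Ig i iq di; rewrite coef_form_deriv.
(* At [i.+1 = q] the coefficient of [g] is not controlled, but its multiplier is [q = 0] in [k]; the
   same happens below when [d = q + i]. *)
have -> : c * i.+1%:R * g`_i.+1 = 0.
  have [iq1|->] : (i.+1 < q \/ i.+1 = q)%N by lia.
    by rewrite Ig ?mulr0 //; lia.
  by rewrite q0 mulr0 mul0r.
have [di'|->] : (d < q + i \/ d = q + i)%N by lia.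
  by rewrite Ig // mulr0 addr0.
by rewrite natrD q0 !add0r subrr mul0r.
Qed.

Lemma form_deriv_exp d c n f :
  form_deriv (d * n.+1) c (f ^+ n.+1) = n.+1%:R *: (form_deriv d c f * f ^+ n).
Proof.
rewrite /form_deriv deriv_exp /= -!mul_polyC !polyC_natr natrM exprS mulr_natl.
by ring.
Qed.

(* Coprime forms of degrees [m] and [n] generate all forms of degree [m + n - 1];
   the size hypothesis says that [y] does not divide both of them. *)
Lemma coprime_forms_generate m n f g h : (0 < m)%N -> (0 < n)%N ->
  coprimep f g -> (size f <= m.+1)%N -> (size g <= n.+1)%N ->
  size f = m.+1 \/ size g = n.+1 -> (size h <= m + n)%N ->
  exists u v, [/\ h = u * f + v * g, (size u <= n)%N & (size v <= m)%N].
Proof.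
wlog sf : m n f g / size f = m.+1 => [WL | ] m0 n0 cop sf' sg' sfg sh.
  case: sfg => [sf | sg]; first by apply: (WL m n) => //; left.
  have [||v [u [-> sv su]]] := WL n m g f sg n0 m0 _ sg' sf' (or_introl sg).
  - by rewrite coprimep_sym.
  - by rewrite addnC.
  by exists u, v; rewrite addrC.
have [[a b] /= eab] := Bezout_eq1_coprimepP _ _ cop.
have f0 : f != 0 by rewrite -size_poly_gt0 sf.
(* Reducing the cofactor of [g] modulo [f] bounds its size; the bound on [u] then follows by
   comparing sizes in [u * f = h - v * g]. *)
pose v : {poly k} := (h * b) %% f; pose u : {poly k} := h * a + ((h * b) %/ f) * g.
have hE : h = u * f + v * g.
  rewrite /u mulrDl -addrA (mulrAC _ g f) -mulrDl -divp_eq.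
  by rewrite -!mulrA -mulrDr eab mulr1.
have sv : (size v <= m)%N by rewrite -ltnS -sf ltn_modp.
clearbody u v; exists u, v; split => //.
have [->|u0] := eqVneq u 0; first by rewrite size_poly0.
have : (size (u * f)%R <= m + n)%N.
  have -> : u * f = h - v * g by rewrite {1}hE addrK.
  rewrite (leq_trans (size_polyD _ _)) // geq_max sh size_polyN.
  rewrite (leq_trans (size_polyMleq _ _)) // -subn1 leq_subLR add1n.
  by rewrite (leq_trans (leq_add sv sg')) // addnS leqnn.
rewrite (size_mul u0 f0) sf; move: u0; rewrite -size_poly_gt0; case: (size u) => [|s] //; lia.
Qed.

End FormDeriv.

(** Together with [d <= size f <= d.+1], which allows at most a simple root at infinity, this
    encodes reducedness of the form of degree [d]. *)
Definition simple_roots (k : fieldType) (f : {poly k}) : Prop :=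
  forall a, root f a -> ~~ root f^`() a.

Section SimpleRoots.
Variables (k : closedFieldType) (p d : nat) (f : {poly k}).
Hypotheses (pchark : p \in [pchar k]) (d_gt1 : (1 < d)%N).
Hypotheses (f_simple : simple_roots f) (ltdf : (d <= size f <= d.+1)%N).

Lemma size_form_deriv c : (size (form_deriv d c f) <= d)%N.
Proof.
have /andP[_ sf] := ltdf.
apply/leq_sizeP => i le_di; rewrite coef_form_deriv.
rewrite nth_default ?mulr0 ?add0r ?(leq_trans sf) //.
have [->|lt_di] : (i = d \/ d < i)%N by lia.
  by rewrite subrr mul0r.
by rewrite nth_default ?mulr0 // (leq_trans sf).
Qed.

(** If [y] divides the form, it must not divide the derived one too: the coefficient there in degree
    [d - 1] is [d - (d - 1) = 1] times the leading one of [f]. *)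
Lemma form_deriv_size c : size f = d -> size (form_deriv d c f) = d.
Proof.
move=> sf; apply/eqP; rewrite eqn_leq size_form_deriv /=.
rewrite leqNgt; apply/negP => lt_sd.
have : (form_deriv d c f)`_d.-1 = 0 by rewrite nth_default // -ltnS prednK // ltnW.
rewrite coef_form_deriv prednK; last by lia.
rewrite [f`_d]nth_default ?sf // mulr0 add0r -natrB; last by lia.
have -> : (d - d.-1 = 1)%N by lia.
rewrite mul1r -sf -/(lead_coef f) => /eqP.
by rewrite lead_coef_eq0 -size_poly_eq0 sf; case: (d) d_gt1.
Qed.

(** At a root [a] of [f] the derived form takes the value [c - a] times the derivative of [f], and
    neither factor vanishes. *)
Lemma coprimep_form_deriv c : f.[c] != 0 -> coprimep f (form_deriv d c f).
Proof.
move=> fc; rewrite coprimep_def; apply/negPn/negP => /closed_rootP [a].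
rewrite root_gcd => /andP[ra]; rewrite rootE hornerD hornerZ (rootP ra) mulr0.
rewrite addr0 hornerM hornerD hornerN hornerC hornerX mulf_eq0 subr_eq0.
rewrite -rootE (negPf (f_simple ra)) orbF => /eqP eca.
by rewrite eca (rootP ra) eqxx in fc.
Qed.

(* The derivation [c d/dx + d/dy] kills [x^q] and [y^q], so it sends [f^(n+1)] to an
   element of the ideal; hence [f^n] is multiplied into the ideal by the two coprime
   forms [f] and [form_deriv d c f], so by all forms of degree [2d - 2]. *)
Lemma frob_ideal_exp_step n e : ~~ (p %| n.+1)%N ->
  frob_ideal (d * n.+1) (p ^ e) (f ^+ n.+1) -> (d * n.+2 <= 2 * p ^ e)%N ->
  frob_ideal (d * n) (p ^ e) (f ^+ n).
Proof.
move=> pn If le_q; have /andP[le_df sf] := ltdf.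
have e0 : (0 < e)%N by case: e le_q {If} => // le_q; nia.
have f0 : f != 0 by rewrite -size_poly_gt0; lia.
have [c fc] := closed_nonrootP _ f0.
have Ig : frob_ideal (d * n.+1).-1 (p ^ e) (form_deriv d c f * f ^+ n).
  have := frob_ideal_deriv c _ (natr_pchar_expn pchark e0) If.
  rewrite form_deriv_exp => Id i iq di.
  have : (n.+1%:R *: (form_deriv d c f * f ^+ n))`_i = 0 by apply: Id => //; lia.
  rewrite coefZ => /eqP; rewrite mulf_eq0 -(dvdn_pcharf pchark) (negPf pn).
  by move/eqP.
(* Forms of degrees [d] and [d - 1] generate everything in degree [2 * d - 2], and [le_q] is exactly
   the socle condition for this [s]. *)
apply: (@frob_ideal_colon _ _ _ (2 * d - 2)); first by lia.
move=> j le_j; have d1 : (0 < d.-1)%N by lia.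
have [||||//||u [v [-> su sv]]] := @coprime_forms_generate _ d d.-1 f
  (form_deriv d c f) 'X^j _ d1; rewrite ?size_polyXn ?prednK //; try lia.
- exact: coprimep_form_deriv.
- exact: size_form_deriv.
- have [sfd|] : size f = d \/ size f = d.+1 by lia.
    by right; rewrite form_deriv_size.
  by left.
rewrite mulrDl -!mulrA -exprS; apply: frob_idealD.
  have -> : (d * n + (2 * d - 2) = d * n.+1 + (d - 2))%N by lia.
  by apply: frob_idealM => //; rewrite (leq_trans su) //; lia.
have -> : (d * n + (2 * d - 2) = (d * n.+1).-1 + (d - 1))%N by lia.
by apply: frob_idealM => //; rewrite (leq_trans sv) //; lia.
Qed.

(** Frobenius carries nonmembership from [a] to [p * a] one level up; strictly between [p * a] and
    [p * a.+1] no exponent is divisible by [p], so [frob_ideal_exp_step] carries it on to [n]. *)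
Lemma not_frob_ideal_exp_climb a q n : ~ frob_ideal (d * a) (p ^ q) (f ^+ a) ->
  (p * a <= n < p * a.+1)%N -> (d * n.+1 <= 2 * p ^ q.+1)%N ->
  ~ frob_ideal (d * n) (p ^ q.+1) (f ^+ n).
Proof.
move=> nIa; have p0 : (0 < p)%N by rewrite prime_gt0 // (pcharf_prime pchark).
elim: n => [|n IH] /andP[le_an lt_na] le_q.
  have a0 : a = 0%N.
    by move: le_an; rewrite leqn0 muln_eq0 => /orP[] /eqP //; lia.
  move=> I; apply: nIa; rewrite a0 muln0 => i iq di; apply: I; last by lia.
  by rewrite expnS; nia.
have [eq_n|lt_n] : (n.+1 = p * a \/ p * a <= n)%N by lia.
  rewrite eq_n expnSr => I; apply/nIa/(frob_ideal_frob pchark _ _ 1).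
  by rewrite expn1 -exprM -mulnA (mulnC a).
move=> I; apply: (IH _ _); [lia | nia | ].
apply: frob_ideal_exp_step I _ => //; apply/negP => /dvdnP[b def_n].
have : (p * a < p * b)%N by rewrite (mulnC p b) -def_n.
have : (p * b < p * a.+1)%N by rewrite (mulnC p b) -def_n.
by rewrite !ltn_pmul2l // => ? ?; lia.
Qed.

End SimpleRoots.

(** * Dehomogenization of binary forms *)

Section BinaryForms.
Variable k : fieldType.
Implicit Types (f g h : {mpoly k[2]}) (phi psi : {poly k}) (d q n i j : nat).

Definition bimon i j : 'X_{1..2} := (U_(ord0) *+ i + U_(ord_max) *+ j)%MM.

Lemma ord2P (i : 'I_2) : i = ord0 \/ i = ord_max.
Proof.
by case: i => [[|[|i]] //] lti; [left | right]; apply: val_inj.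
Qed.

Lemma bimon0 i j : bimon i j ord0 = i.
Proof. by rewrite mnmDE !mulmnE !mnm1E /= mul1n mul0n addn0. Qed.

Lemma bimon1 i j : bimon i j ord_max = j.
Proof. by rewrite mnmDE !mulmnE !mnm1E /= mul1n mul0n add0n. Qed.

Lemma bimonE (m : 'X_{1..2}) : m = bimon (m ord0) (m ord_max).
Proof.
apply/mnmP => i.
by have [->|->] := ord2P i; rewrite ?bimon0 ?bimon1.
Qed.

Lemma mdeg_bimon i j : mdeg (bimon i j) = (i + j)%N.
Proof. by rewrite mdegD !mdegMn !mdeg1 !mul1n. Qed.

Lemma mdeg2 (m : 'X_{1..2}) : mdeg m = (m ord0 + m ord_max)%N.
Proof. by rewrite {1}(bimonE m) mdeg_bimon. Qed.

Lemma mpolyX_bimon i j : 'X_[bimon i j] = 'X_ord0 ^+ i * 'X_ord_max ^+ j :> {mpoly k[2]}.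
Proof. by rewrite mpolyXD !mpolyXn. Qed.

Definition dehom : {rmorphism {mpoly k[2]} -> {poly k}} :=
  mmap (@polyC k) (fun i : 'I_2 => if i == ord0 then 'X else 1).

Lemma dehomX m : dehom 'X_[m] = 'X^(m ord0).
Proof.
by rewrite /= mmapX /mmap1 big_ord_recl big_ord1 /= expr1n mulr1.
Qed.

Lemma dehomZ c f : dehom (c *: f) = c *: dehom f.
Proof. by rewrite /= mmapZ mul_polyC. Qed.

Lemma size_dehom f : (size (dehom f) <= msize f)%N.
Proof.
apply/leq_sizeP => i le_i; rewrite {1}[f]mpolyE raddf_sum coef_sum /= big_seq.
rewrite big1 // => m mf; rewrite dehomZ dehomX coefZ coefXn.
case: eqP => [ei|_]; last by rewrite mulr0.
have := msize_mdeg_lt mf; rewrite mdeg2; lia.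
Qed.

Lemma size_dehom_homog d f : f \is d.-homog -> (size (dehom f) <= d.+1)%N.
Proof.
move=> hf; apply: leq_trans (size_dehom f) _.
by rewrite msizeE; apply/bigmax_leqP_seq => m mf _; rewrite ltnS (dhomog_mf hf mf).
Qed.

Definition homogenize d phi : {mpoly k[2]} := \sum_(i < d.+1) phi`_i *: 'X_[bimon i (d - i)].

Lemma homogenize_homog d phi : homogenize d phi \is d.-homog.
Proof.
apply: rpred_sum => i _; apply: rpredZ; rewrite dhomogX; apply/eqP.
transitivity (mdeg (bimon i (d - i))) => //.
by rewrite mdeg_bimon; have := ltn_ord i; lia.
Qed.

Lemma coef_dehom d f i j : f \is d.-homog -> (i + j = d)%N ->
  (dehom f)`_i = f@_(bimon i j).
Proof.
move=> hf def_d; rewrite {1}[f]mpolyE raddf_sum coef_sum /=.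
transitivity (\sum_(m <- msupp f | m == bimon i j) f@_m).
  rewrite [RHS]big_mkcond /= !big_seq; apply: eq_bigr => m mf.
  rewrite -/(dehom _) dehomZ dehomX coefZ coefXn.
  have dm : mdeg m = d := dhomog_mf hf mf; rewrite mdeg2 in dm.
  case: (eqVneq m (bimon i j)) => [->|ne]; first by rewrite bimon0 eqxx mulr1.
  case: eqP => [ei|_]; last by rewrite mulr0.
  by case/eqP: ne; rewrite (bimonE m) -ei; congr bimon; lia.
case: (boolP (bimon i j \in msupp f)) => [mf | nmf].
  rewrite big_mkcond (bigD1_seq (bimon i j)) //= eqxx big1 ?addr0 // => m ne.
  by rewrite (negPf ne).
rewrite (memN_msupp_eq0 nmf) big_seq_cond big1 // => m /andP[mf /eqP em].
by rewrite em (negPf nmf) in mf.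
Qed.

Lemma coef_homogenize d phi i j : (i + j = d)%N -> (homogenize d phi)@_(bimon i j) = phi`_i.
Proof.
move=> def_d; rewrite raddf_sum /=.
have lt_i : (i < d.+1)%N by lia.
rewrite (bigD1 (Ordinal lt_i)) //= mcoeffZ mcoeffX.
have -> : (d - i = j)%N by lia.
rewrite eqxx mulr1 big1 ?addr0 // => l ne; rewrite mcoeffZ mcoeffX.
case: eqP => [/(congr1 (fun m : 'X_{1..2} => m ord0))|_]; last by rewrite mulr0.
by rewrite !bimon0 => el; case/eqP: ne; apply: val_inj.
Qed.

Lemma homog_eq d f g : f \is d.-homog -> g \is d.-homog ->
  (forall i j, (i + j = d)%N -> f@_(bimon i j) = g@_(bimon i j)) -> f = g.
Proof.
move=> hf hg eq_fg; apply/mpolyP => m; rewrite (bimonE m).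
have [/eq_fg //|ne] := eqVneq (m ord0 + m ord_max)%N d.
have ne' : mdeg (bimon (m ord0) (m ord_max)) != d by rewrite mdeg_bimon.
by rewrite (dhomog_nemf_coeff hf ne') (dhomog_nemf_coeff hg ne').
Qed.

Lemma dehomK d f : f \is d.-homog -> homogenize d (dehom f) = f.
Proof.
move=> hf; apply: (homog_eq (homogenize_homog _ _) hf) => i j def_d.
by rewrite coef_homogenize // (coef_dehom hf def_d).
Qed.

Lemma homogenizeK d phi : (size phi <= d.+1)%N -> dehom (homogenize d phi) = phi.
Proof.
move=> sp; rewrite raddf_sum /=; apply/polyP => i; rewrite coef_sum.
under eq_bigr => j _ do rewrite dehomZ dehomX bimon0 coefZ coefXn.
case: (ltnP i d.+1) => [lt_id | le_di].
  rewrite (bigD1 (Ordinal lt_id)) //= eqxx mulr1 big1 ?addr0 // => j ne.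
  by case: eqP => [ei|_]; [case/eqP: ne; apply: val_inj | rewrite mulr0].
rewrite nth_default ?(leq_trans sp) // big1 // => j _.
by have := ltn_ord j; case: eqP => [ei|_ _]; [lia | rewrite mulr0].
Qed.

Lemma dehom_inj d : {in d.-homog &, injective dehom}.
Proof. by move=> f g hf hg eq_fg; rewrite -(dehomK hf) eq_fg dehomK. Qed.

Lemma mcoeffMXU f (l : 'I_2) q (m : 'X_{1..2}) : (m l < q)%N ->
  (f * 'X_l ^+ q)@_m = 0.
Proof.
move=> lt_q; rewrite [f]mpolyE mulr_suml raddf_sum /= big1 // => m' _.
rewrite mpolyXn -scalerAl -mpolyXD mcoeffZ mcoeffX.
case: eqP => [def_m|_]; last by rewrite mulr0.
by move: lt_q; rewrite -def_m mnmDE mulmnE mnm1E eqxx; lia.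
Qed.

(** The ideal is monomial: terms with [q <= i] go into the multiple of [x^q], and the other nonzero
    terms are divisible by [y^q]. *)
Lemma in_ideal_frob d q f : f \is d.-homog ->
  in_ideal_xy_pow q f <-> frob_ideal d q (dehom f).
Proof.
move=> hf; have ord_maxE : (1 : 'I_2) = ord_max by apply: val_inj.
split=> [[a [b def_f]] i iq di | If].
  have [le_id|lt_di] := leqP i d; last first.
    by rewrite nth_default // (leq_trans (size_dehom_homog hf)).
  rewrite (coef_dehom hf (subnKC le_id)) def_f mcoeffD.
  rewrite !mcoeffMXU ?addr0 // ?ord_maxE ?bimon0 ?bimon1 //; lia.
exists (\sum_(i < d.+1 | (q <= i)%N) (dehom f)`_i *: 'X_[bimon (i - q) (d - i)]).
exists (\sum_(i < d.+1 | ~~ (q <= i)%N) (dehom f)`_i *: 'X_[bimon i (d - i - q)]).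
rewrite -{1}(dehomK hf) {1}/homogenize (bigID (fun i : 'I_d.+1 => (q <= i)%N)) /=.
rewrite ord_maxE !mulr_suml; congr (_ + _); apply: eq_bigr => i le_q.
  by rewrite -scalerAl !mpolyX_bimon mulrAC -exprD subnK.
have [le_d|lt_d] := leqP (q + i) d.
  by rewrite -scalerAl !mpolyX_bimon -mulrA -exprD subnK //; lia.
by rewrite If ?scale0r ?mul0r //; lia.
Qed.

End BinaryForms.

(** * Reduced forms and their dehomogenizations *)

Section ReducedForms.
Variable k : closedFieldType.
Implicit Types (f g h : {mpoly k[2]}) (phi psi : {poly k}) (d : nat).

Lemma mpoly_unitE f : (f \is a GRing.unit) = (msize f == 1%N).
Proof.
apply/idP/eqP => [Uf | sf].
  have := congr1 (fun g : {mpoly k[2]} => msize g) (divrr Uf); rewrite /= msize1.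
  have f0 : f != 0 by apply: contraTneq Uf => ->; rewrite unitr0.
  have f'0 : f^-1 != 0 by rewrite invr_eq0.
  rewrite msizeM //; move: f0 f'0; rewrite -!msize_poly_eq0.
  by move: (msize f) (msize f^-1) => a b; lia.
have [c c0 ->] := msize_poly1P _ (introT eqP sf).
by apply/unitrP; exists c^-1%:MP; rewrite -!mpolyCM mulVf // mulfV.
Qed.

Lemma msize_homog d f : f != 0 -> f \is d.-homog -> msize f = d.+1.
Proof.
move=> f0 hf; rewrite -mlead_deg //; congr S.
exact: (dhomog_mf hf (mlead_supp f0)).
Qed.

Lemma irreducible_linear_form g : g != 0 -> g \is 1.-homog -> irreducible_elt g.
Proof.
move=> g0 hg; have sg := msize_homog g0 hg.
split => // [|a b def_g]; first by rewrite mpoly_unitE sg.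
have a0 : a != 0 by apply: contraNneq g0 => a0; rewrite def_g a0 mul0r.
have b0 : b != 0 by apply: contraNneq g0 => b0; rewrite def_g b0 mulr0.
move: sg a0 b0; rewrite def_g !mpoly_unitE => sg a0 b0.
move: sg; rewrite msizeM //; move: a0 b0; rewrite -!msize_poly_eq0.
by move: (msize a) (msize b) => m n *; apply/orP; lia.
Qed.

Lemma double_root_factor phi a : root phi a -> root phi^`() a ->
  exists psi, phi = psi * ('X - a%:P) ^+ 2.
Proof.
move=> /factor_theorem [psi ->]; rewrite derivM derivXsubC mulr1.
rewrite rootE hornerD hornerM hornerXsubC subrr mulr0 add0r => /factor_theorem.
by case=> psi' ->; exists psi'; rewrite -mulrA.
Qed.

Lemma dehom_XU1 : dehom k 'X_ord_max = 1.
Proof. by rewrite dehomX mnm1E expr0. Qed.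

(** A double root [a] would make the square of [x - a y] divide the form, and a size below [d] would
    make [y^2] divide it. *)
Lemma reduced_form_dehom d f : (1 < d)%N -> reduced_form d f ->
  simple_roots (dehom k f) /\ (d <= size (dehom k f) <= d.+1)%N.
Proof.
move=> d1 [f0 hf redf].
have sf := size_dehom_homog hf.
have df0 : dehom k f != 0.
  by apply: contraNneq f0 => df0; rewrite -(dehomK hf) df0; apply/eqP/big1 => i _;
    rewrite coef0 scale0r.
have def_d : (d = d.-2 + 1 * 2)%N by lia.
split=> [a ra | ].
  apply/negP => /(double_root_factor ra) [psi def_phi].
  have psi0 : psi != 0 by apply: contraNneq df0 => psi0; rewrite def_phi psi0 mul0r.
  have spsi : (size psi <= d.-2.+1)%N.
    move: sf; rewrite def_phi size_mul // ?expf_neq0 ?polyXsubC_eq0 //.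
    by rewrite size_exp_XsubC; move: (size psi) => n; lia.
  have dX : dehom k (homogenize 1 ('X - a%:P)) = 'X - a%:P by rewrite homogenizeK // size_XsubC.
  apply: (redf (homogenize 1 ('X - a%:P))).
    apply: irreducible_linear_form (homogenize_homog _ _).
    by apply: contra_eq_neq dX => ->; rewrite rmorph0 eq_sym polyXsubC_eq0.
  exists (homogenize d.-2 psi); apply: (dehom_inj hf).
    by rewrite {2}def_d dhomogM ?dhomogMn ?homogenize_homog.
  by rewrite rmorphM rmorphXn /= dX homogenizeK.
rewrite sf andbT leqNgt; apply/negP => lt_s.
apply: (redf 'X_ord_max).
  apply: irreducible_linear_form; last by rewrite dhomogX /= mdeg1.
  by rewrite -msize_poly_eq0 msizeX.
have spsi : (size (dehom k f) <= d.-2.+1)%N by lia.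
exists (homogenize d.-2 (dehom k f)); apply: (dehom_inj hf).
  rewrite {2}def_d dhomogM ?homogenize_homog // dhomogMn // dhomogX /=.
  by rewrite mdeg1.
by rewrite rmorphM rmorphXn /= dehom_XU1 expr1n mulr1 homogenizeK.
Qed.

(* If [g^2] divides the form and [g] has no zero in the chart [y = 1], then [g]
   dehomogenizes to a constant, so the cofactor has degree at most [d - 2] but the same
   dehomogenization: [y^2] divides the form. *)
Lemma reduced_form_homogenize d phi :
  simple_roots phi -> (d <= size phi <= d.+1)%N -> (0 < d)%N ->
  reduced_form d (homogenize d phi).
Proof.
move=> simp /andP[le_d le_s] d0.
have phiK : dehom k (homogenize d phi) = phi by rewrite homogenizeK.
have phi0 : phi != 0 by rewrite -size_poly_gt0; lia.
have f0 : homogenize d phi != 0.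
  by apply: contra_eq_neq phiK => ->; rewrite rmorph0 eq_sym.
split; [by [] | exact: homogenize_homog | ].
move=> g [g0 nUg _] [h def_f]; move: (congr1 (dehom k) def_f).
rewrite phiK rmorphM rmorphXn /= -/(dehom k) => def_phi.
have dg0 : dehom k g != 0.
  by apply: contraNneq phi0 => dg0; rewrite def_phi dg0 expr0n mulr0.
have h0 : h != 0 by apply: contraNneq f0 => h0; rewrite def_f h0 mul0r.
have [sg | /closed_rootP [a ra]] := eqVneq (size (dehom k g)) 1%N.
  have := msize_homog f0 (homogenize_homog _ _).
  have sh := size_dehom h.
  have : size phi = size (dehom k h).
    have [c c0 def_c] := size_poly1P _ (introT eqP sg).
    by rewrite def_phi def_c -polyC_exp mulrC size_Cmul // expf_neq0.
  rewrite def_f msizeM ?expf_neq0 // msizeM //.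
  move: le_d sh g0 h0 nUg; rewrite mpoly_unitE -!msize_poly_eq0.
  move: (msize g) (msize h) (size phi) (size _) => a b c e; lia.
have /factor_theorem [u def_u] := ra.
have {}def_phi : phi = dehom k h * u ^+ 2 * ('X - a%:P) ^+ 2.
  by rewrite def_phi def_u exprMn mulrA.
have := simp a; rewrite def_phi !rootE derivM deriv_exp derivXsubC.
rewrite !(hornerXsubC, horner_exp, hornerMn, hornerM, hornerD) subrr.
by rewrite expr0n /= !mulr0 mul0rn mulr0 addr0 eqxx => /(_ isT).
Qed.

End ReducedForms.

(** * F-pure thresholds *)

Section Threshold.
Variables (R : realType) (k : closedFieldType) (p d : nat) (f : {mpoly k[2]}).
Hypotheses (pchark : p \in [pchar k]) (f_homog : f \is d.-homog).
Local Notation phi := (dehom k f).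
Local Notation nonmember n e := (~ frob_ideal (d * n) (p ^ e) (phi ^+ n)).

(** The supremum is pinned by a bound valid at all levels and by exponents missing it by at most
    [c / p ^ e] at arbitrarily high levels [e]. *)
Lemma fpt_eq a b c : (0 < b)%N ->
  (forall n e, nonmember n e -> (b * n <= a * p ^ e)%N) ->
  (forall j, exists e n, [/\ (j <= e)%N, (a * p ^ e <= b * n + c)%N & nonmember n e]) ->
  fpt R p f = a%:R / b%:R.
Proof.
move=> b0 ub lb; have bR : 0 < b%:R :> R by rewrite ltr0n.
have qR e : 0 < p%:R ^+ e :> R.
  by rewrite exprn_gt0 // ltr0n prime_gt0 // (pcharf_prime pchark).
have memP n e : in_ideal_xy_pow (p ^ e) (f ^+ n) <-> frob_ideal (d * n) (p ^ e) (phi ^+ n).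
  by rewrite -rmorphXn; apply: in_ideal_frob; apply: dhomogMn.
rewrite /fpt; set S := [set _ | _]%classic.
have ubS : ubound S (a%:R / b%:R).
  move=> _ [n [e [-> nIn]]]; rewrite ler_pdivrMr // mulrAC ler_pdivlMr //.
  rewrite -natrX -!natrM ler_nat mulnC; apply: ub; move: nIn.
  by apply: contra_not => /memP.
have [e0 [n0 [_ _ nI0]]] := lb 0%N.
have S0 : (S !=set0)%classic.
  by exists (n0%:R / p%:R ^+ e0), n0, e0; split=> // /memP.
apply/eqP; rewrite eq_le ge_sup //= leNgt; apply/negP => lt_s.
set s := sup S in lt_s; set dl := a%:R / b%:R - s.
have dl0 : 0 < dl by rewrite subr_gt0.
(* At such a level the error [c / p ^ e] is below the gap [dl], since [e < p ^ e]. *)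
have [e [n [le_e le_a nI]]] := lb (Num.truncn (c%:R / dl)).+1.
have le_ns : n%:R / p%:R ^+ e <= s.
  apply: ub_le_sup; first by exists (a%:R / b%:R).
  by exists n, e; split=> // /memP.
have : dl * p%:R ^+ e <= c%:R.
  have : a%:R / b%:R - n%:R / p%:R ^+ e <= c%:R / p%:R ^+ e :> R.
    rewrite lerBlDr -mulrDl ler_pdivrMr // mulrAC ler_pdivlMr // -natrX -natrD -!natrM.
    by rewrite ler_nat (leq_trans le_a) //; nia.
  rewrite -ler_pdivlMr //; apply: le_trans.
  by rewrite /dl lerD2l lerN2.
apply/negP; rewrite -ltNge mulrC -ltr_pdivrMr //.
apply: lt_le_trans (truncnS_gt _) _.
rewrite -natrX ler_nat (leq_trans le_e) // ltnW // ltn_expl // prime_gt1 //.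
exact: pcharf_prime pchark.
Qed.

(** Frobenius spreads the membership of the power [n0.+1] to every level, giving the upper bound;
    climbing keeps the exponent [n0.+1 * p ^ j - 1] outside at level [e0 + j], giving the lower
    one. *)
Lemma fpt_level n0 e0 : (1 < d)%N -> simple_roots phi ->
  (d <= size phi <= d.+1)%N ->
  (d * n0.+1 <= 2 * p ^ e0)%N -> frob_ideal (d * n0.+1) (p ^ e0) (phi ^+ n0.+1) ->
  nonmember n0 e0 -> fpt R p f = n0.+1%:R / p%:R ^+ e0.
Proof.
move=> d1 simp sphi le_n0 I0 nI0; rewrite -natrX.
have q0 := pcharf_expn_gt0 pchark.
have p0 : (0 < p)%N by rewrite prime_gt0 // (pcharf_prime pchark).
have I j m : (n0.+1 * p ^ j <= m)%N -> frob_ideal (d * m) (p ^ (e0 + j)) (phi ^+ m).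
  move=> le_m; rewrite -(subnK le_m) mulnDr exprD.
  rewrite [(d * _ + _)%N]addnC; apply: frob_idealM.
    by apply: size_exp_bound; case/andP: sphi.
  by rewrite exprM expnD mulnA; apply/(frob_ideal_frob pchark).
apply: (@fpt_eq _ _ (p ^ e0)) => // [n e nI | j].
  rewrite leqNgt; apply/negP => lt_n; apply: nI.
  apply/(frob_ideal_frob pchark _ _ e0); rewrite -exprM -mulnA -expnD addnC.
  by apply: I; rewrite (mulnC n) ltnW.
exists (e0 + j)%N, (n0.+1 * p ^ j).-1; split; first by rewrite leq_addl.
  by rewrite expnD; have := q0 j; nia.
elim: j => [|j IH]; first by rewrite muln1 addn0.
have nj : (0 < n0.+1 * p ^ j)%N by rewrite muln_gt0 q0.
rewrite addnS; apply: (not_frob_ideal_exp_climb pchark d1 simp sphi IH).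
  rewrite expnSr mulnA; move: (n0.+1 * p ^ j)%N nj => N N0.
  by case: N N0 => // N _; case: (p) p0 => // p' _; apply/andP; split; nia.
rewrite prednK ?muln_gt0 ?q0 // -addnS expnD !mulnA.
by rewrite leq_mul2r le_n0 orbT.
Qed.

(** The coefficient in degree [p ^ e - 1] is the socle coefficient. It multiplies, up to Frobenius,
    when base [p ^ e] digits of the exponent are appended, so it survives at all levels [e * j];
    above [2 / d] every power is in the ideal for degree reasons. *)
Lemma fpt_top n e : (0 < d)%N -> (size phi <= d.+1)%N -> (0 < e)%N ->
  (d * n + 2 = 2 * p ^ e)%N -> (phi ^+ n)`_(p ^ e).-1 != 0 ->
  fpt R p f = 2%:R / d%:R.
Proof.
move=> d0 sphi e0 def_n cn; have q0 := pcharf_expn_gt0 pchark.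
have sizeX := size_exp_bound _ sphi.
have topj j : exists m, (d * m + 2 = 2 * p ^ (e * j))%N /\
    (phi ^+ m)`_(p ^ (e * j)).-1 != 0.
  elim: j => [|j [m [def_m cm]]].
    by exists 0%N; rewrite !muln0 expn0 expr0 coef1 oner_eq0.
  exists (m * p ^ e + n)%N; split.
    rewrite mulnS expnD; nia.
  have := sizeX m; rewrite exprD exprM => sm.
  rewrite (coef_frobM pchark _ _ _ sm) mulnS expnD.
  have lt_m : ((p ^ (e * j)).-1 < (d * m).+1)%N by have := q0 (e * j)%N; lia.
  rewrite (bigD1 (Ordinal lt_m)) /=; last by have := q0 e; have := q0 (e * j)%N; nia.
  rewrite big1 ?addr0 => [|i /andP[le_i ne_i]].
    rewrite mulf_eq0 expf_eq0 q0 /= (negPf cm) /=.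
    have -> : ((p ^ e * p ^ (e * j)).-1 - p ^ e * (p ^ (e * j)).-1 = (p ^ e).-1)%N => //.
    by have := q0 e; have := q0 (e * j)%N; nia.
  (* Any smaller [i] asks for a coefficient of [phi ^+ n] beyond degree [d * n]. *)
  rewrite [X in _ * X]nth_default ?mulr0 // (leq_trans (sizeX n)) //.
  have : (i : nat) != (p ^ (e * j)).-1 by apply: contraNneq ne_i => ei; apply/eqP/val_inj.
  by have := q0 e; have := q0 (e * j)%N; nia.
apply: (@fpt_eq _ _ 2) => // [m i nI | j].
  by rewrite leqNgt; apply/negP => lt_m; apply: nI; apply: frob_ideal_large; lia.
have [m [def_m cm]] := topj j; exists (e * j)%N, m; split; first by rewrite leq_pmull.
  by rewrite -def_m.
move=> I; case/eqP: cm; have := q0 (e * j)%N => ?; apply: I; lia.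
Qed.

End Threshold.

(** * Thresholds of sextics read off from coefficients *)

Section SexticThresholds.
Variables (R : realType) (k : closedFieldType) (p : nat) (phi : {poly k}).
Hypotheses (pchark : p \in [pchar k]) (phi_simple : simple_roots phi).
Hypothesis size_phi : (6 <= size phi <= 7)%N.
Local Notation f := (homogenize 6 phi).
Local Notation nonmember n e := (~ frob_ideal (6 * n) (p ^ e) (phi ^+ n)).

Lemma dehom_sextic : dehom k f = phi.
Proof. by rewrite homogenizeK; case/andP: size_phi. Qed.

Lemma frob_ideal_socle d q (g : {poly k}) :
  (d + 2 = 2 * q)%N -> g`_q.-1 = 0 -> frob_ideal d q g.
Proof.
by move=> def_d g0 i iq di; have -> : (i = q.-1)%N by lia.
Qed.

Lemma not_frob_ideal_exp0 e : nonmember 0%N e.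
Proof.
have q0 := pcharf_expn_gt0 pchark e.
move=> /(_ 0%N q0); rewrite muln0 addn0 => /(_ q0) /eqP.
by rewrite expr0 coef1 oner_eq0.
Qed.

Lemma sextic_fpt_level n0 e0 : (6 * n0.+1 <= 2 * p ^ e0)%N ->
  frob_ideal (6 * n0.+1) (p ^ e0) (phi ^+ n0.+1) -> nonmember n0 e0 ->
  fpt R p f = n0.+1%:R / p%:R ^+ e0.
Proof.
move=> le_n I nI; apply: (fpt_level _ pchark (homogenize_homog _ _));
  by rewrite ?dehom_sextic.
Qed.

Lemma sextic_fpt_top n e : (0 < e)%N -> (6 * n + 2 = 2 * p ^ e)%N ->
  (phi ^+ n)`_(p ^ e).-1 != 0 -> fpt R p f = 1 / 3%:R.
Proof.
move=> e0 def_n cn.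
have -> : 1 / 3%:R = 2%:R / 6%:R :> R by field.
apply: (fpt_top _ pchark (homogenize_homog 6 phi) _ _ e0 def_n);
  by rewrite ?dehom_sextic //; case/andP: size_phi.
Qed.

Lemma not_frob_ideal_first_level n : (6 * n.+1 <= 2 * p)%N -> nonmember n 1%N.
Proof.
move=> le_n; apply: (@not_frob_ideal_exp_climb _ p 6 _ pchark _ phi_simple size_phi 0 0).
- by [].
- exact: not_frob_ideal_exp0.
- by rewrite muln0 muln1; lia.
- by rewrite expn1.
Qed.

Lemma fpt_char3 : p = 3%N -> fpt R p f = 1 / 3%:R.
Proof.
move=> p3; rewrite (@sextic_fpt_level 0 1) ?p3 ?expr1 //.
  by apply: frob_ideal_large.
by have := @not_frob_ideal_exp0 1; rewrite p3.
Qed.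

(** Since [6 = 2 * 4 - 2] is the socle degree for [q = 4], the coefficient of [x^3 y^3] decides
    everything. *)
Lemma fpt_char2 : p = 2%N ->
  fpt R p f = if phi`_3 == 0 then 1 / 4%:R else 1 / 3%:R.
Proof.
move=> p2; case: eqP => [c0|/eqP c0]; last first.
  by apply: (@sextic_fpt_top 1 2); rewrite ?p2 ?expr1.
rewrite (@sextic_fpt_level 0 2) ?p2 //.
- by rewrite -natrX.
- by apply: frob_ideal_socle; rewrite ?expr1.
by have := @not_frob_ideal_exp0 2; rewrite p2.
Qed.

(** Here [6 * n = 2 * p - 2] is already the socle degree for [q = p], so the first level decides. *)
Lemma fpt_mod1 n : (p = 3 * n + 1)%N ->
  fpt R p f = if (phi ^+ n)`_(3 * n) == 0 then (p%:R - 1) / (3%:R * p%:R) else 1 / 3%:R.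
Proof.
move=> def_p; have p_pr := pcharf_prime pchark.
have def_p1 : (p ^ 1).-1 = (3 * n)%N by rewrite expn1; lia.
case: eqP => [c0|/eqP c0]; last first.
  by apply: (@sextic_fpt_top n 1); rewrite ?def_p1 // expn1; lia.
have p1 := prime_gt1 p_pr.
case: n def_p def_p1 c0 => [|n] def_p def_p1 c0; first by lia.
have pR : p%:R != 0 :> R by rewrite pnatr_eq0; lia.
rewrite (@sextic_fpt_level n 1) ?expr1 ?expn1; [|lia|apply: frob_ideal_socle|].
- by rewrite def_p natrD natrM addrK -mulf_div divff ?mul1r // pnatr_eq0.
- by lia.
- by move: c0; rewrite -def_p1 expn1.
have := @not_frob_ideal_first_level n; rewrite expn1; apply; lia.
Qed.

Lemma fpt_mod2_low n : (0 < n)%N -> (p = 3 * n + 2)%N ->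
  frob_ideal (6 * n) p (phi ^+ n) -> fpt R p f = (p%:R - 2%:R) / (3%:R * p%:R).
Proof.
case: n => // n _ def_p I.
rewrite (@sextic_fpt_level n 1) ?expr1 ?expn1; [|lia|by []|].
  by rewrite def_p natrD natrM addrK -mulf_div divff ?mul1r // pnatr_eq0.
have := @not_frob_ideal_first_level n; rewrite expn1; apply; lia.
Qed.

(** Nonmembership of the [n]-th power at level one climbs to the exponent [m - 1] at level two, as
    [p * n <= m - 1 < p * n.+1]; the [m]-th power has socle degree there, so one coefficient puts it
    in the ideal. *)
Lemma fpt_mod2_middle n m : (0 < n)%N -> (p = 3 * n + 2)%N -> (3 * m + 1 = p ^ 2)%N ->
  ~ frob_ideal (6 * n) p (phi ^+ n) -> (phi ^+ m)`_(3 * m) = 0 ->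
  fpt R p f = (p%:R ^+ 2 - 1) / (3%:R * p%:R ^+ 2).
Proof.
move=> n0 def_p def_m nI c0; case: m def_m c0 => [|m] def_m c0; first by nia.
rewrite (@sextic_fpt_level m 2).
- by rewrite -natrX -def_m natrD natrM addrK -mulf_div divff ?mul1r // pnatr_eq0.
- by lia.
- by apply: frob_ideal_socle; rewrite -def_m; [lia | rewrite addn1].
apply: (@not_frob_ideal_exp_climb _ p 6 _ pchark _ phi_simple size_phi n 1) => //.
- by rewrite -mulnn in def_m; nia.
- by lia.
Qed.

Lemma fpt_mod2_top m : (3 * m + 1 = p ^ 2)%N -> (phi ^+ m)`_(3 * m) != 0 ->
  fpt R p f = 1 / 3%:R.
Proof.
move=> def_m c0; apply: (@sextic_fpt_top m 2); rewrite -?def_m ?addn1 //; lia.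
Qed.

End SexticThresholds.

(** * Examples *)

Section BinomialCoefficients.
Variables (R : nzRingType) (p : nat).
Hypothesis pcharR : p \in [pchar R].

Lemma natr_prime_neq0 q : prime q -> p != q -> q%:R != 0 :> R.
Proof.
move=> q_pr ne_pq.
by rewrite -(dvdn_pcharf pcharR) dvdn_prime2 ?(pcharf_prime pcharR).
Qed.

Lemma natr_fact_neq0 n : (n < p)%N -> n`!%:R != 0 :> R.
Proof.
have p_pr := pcharf_prime pcharR.
rewrite -(dvdn_pcharf pcharR); elim: n => [|n IH] lt_n.
  by rewrite dvdn1; apply: contraTneq p_pr => ->.
by rewrite factS Euclid_dvdM // negb_or IH 1?ltnW // gtnNdvd.
Qed.

Lemma natr_bin_neq0 n m : (m <= n < p)%N -> 'C(n, m)%:R != 0 :> R.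
Proof.
case/andP=> le_m lt_n; apply: contraNneq (natr_fact_neq0 lt_n) => c0.
by rewrite -(bin_fact le_m) natrM c0 mul0r.
Qed.

End BinomialCoefficients.

Lemma coef_XnD1_exp (R : comNzRingType) m n i : (0 < m)%N ->
  (('X^m + 1 : {poly R}) ^+ n)`_i = if (m %| i)%N then 'C(n, i %/ m)%:R else 0.
Proof.
move=> m0; have -> : 'X^m + 1 = ('X + 1 : {poly R}) \Po 'X^m.
  by rewrite comp_polyD comp_polyX comp_polyC.
rewrite -rmorphXn /= coef_comp_poly_Xn //; case: ifP => // _.
rewrite addrC exprDn coef_sum.
under eq_bigr => j _ do rewrite expr1n mul1r coefMn coefXn.
case: (leqP (i %/ m) n) => [le_i | lt_i].
  rewrite (bigD1 (Ordinal (le_i : (_ < n.+1)%N))) //= eqxx big1 ?addr0 // => j ne.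
  by case: eqP => [ei|_]; [case/eqP: ne; apply: val_inj | rewrite mul0rn].
rewrite bin_small // big1 // => j _; have := ltn_ord j.
by case: eqP => [ei|_ _]; [lia | rewrite mul0rn].
Qed.

(** * The sextics [b x^6 + x^3 y^3 + b y^6] *)

Section PalindromicSextics.
Variables (k : closedFieldType) (p : nat).
Hypothesis pchark : p \in [pchar k].
Implicit Types (b : k) (n : nat).

Definition middle_trinomial b : {poly k} := 'X + b%:P * ('X^2 + 1).

Definition palindromic_sextic b : {poly k} := middle_trinomial b \Po 'X^3.

Definition central_coef n : {poly k} :=
  \poly_(i < n.+1) ((('X^2 + 1 : {poly k}) ^+ i)`_i *+ 'C(n, i)).

Lemma central_coefE b n :
  (palindromic_sextic b ^+ n)`_(3 * n) = (central_coef n).[b].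
Proof.
rewrite -rmorphXn /= coef_comp_poly_Xn // dvdn_mulr // mulKn //.
rewrite exprDn coef_sum horner_poly; apply: eq_bigr => i _.
have le_i : (i <= n)%N by rewrite -ltnS.
rewrite exprMn mulrCA -polyC_exp coefMn coefCM coefXnM ltnNge leq_subr /=.
by rewrite subKn // mulrC mulrnAl.
Qed.

Lemma palindromic_sexticE b : palindromic_sextic b = 'X^3 + b%:P * ('X^6 + 1).
Proof.
rewrite /palindromic_sextic /middle_trinomial comp_polyD comp_polyX comp_polyM.
by rewrite comp_polyD !comp_polyC comp_Xn_poly -exprM.
Qed.

Lemma palindromic_sextic_simple b : p != 3%N -> b != 0 -> 4%:R * b ^+ 2 != 1 ->
  simple_roots (palindromic_sextic b).
Proof.
move=> p3 b0 b4 t; rewrite palindromic_sexticE !rootE => /eqP rt.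
have k3 : 3%:R != 0 :> k by rewrite (natr_prime_neq0 pchark).
have {}rt : t ^+ 3 + b * (t ^+ 6 + 1) = 0.
  by rewrite -[RHS]rt !(hornerXn, hornerC, hornerM, hornerD).
have t0 : t != 0.
  apply: contraNneq b0 => t0; move: rt.
  by rewrite t0 !expr0n /= !add0r mulr1 => /eqP.
rewrite !(derivXn, derivC, derivM, derivD) mul0r add0r addr0.
rewrite !(hornerMn, hornerXn, hornerC, hornerM, hornerD) /=.
have -> : t ^+ 2 *+ 3 + b * (t ^+ 5 *+ 6) = 3%:R * t ^+ 2 * (1 + 2%:R * b * t ^+ 3).
  by ring.
rewrite !mulf_neq0 ?expf_neq0 //; apply: contraNneq b4 => d0.
rewrite -subr_eq0; apply/eqP.
(* Up to sign this is the discriminant of [X + b (X^2 + 1)], expressed through the trinomial and its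
   derivative at [t^3]. *)
have -> : 4%:R * b ^+ 2 - 1 =
    4%:R * b * (t ^+ 3 + b * (t ^+ 6 + 1)) - (1 + 2%:R * b * t ^+ 3) ^+ 2 by ring.
by rewrite rt d0 mulr0 expr0n subr0.
Qed.

Lemma size_palindromic_sextic b : b != 0 -> size (palindromic_sextic b) = 7%N.
Proof.
move=> b0; rewrite palindromic_sexticE addrC.
by rewrite size_polyDl size_Cmul // size_XnaddC // size_polyXn.
Qed.

Lemma central_coef_neq0 n : central_coef n != 0.
Proof.
apply: contra_neq (oner_neq0 k) => c0.
by rewrite -(coef0 k 0) -c0 coef_poly expr0 coef1 bin0.
Qed.

(** The coefficient of [b^2] is [2 * 'C(n, 2)], nonzero modulo [p]; hence some [b] kills the central
    coefficient. *)
Lemma central_coef_nonconst n : (1 < n < p)%N -> (2 < p)%N -> size (central_coef n) != 1%N.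
Proof.
move=> /andP[n1 np] p2; apply: contraTneq (natr_bin_neq0 pchark (n := n) (m := 2) _) => [s1|].
  have : (central_coef n)`_2 = 0 by rewrite nth_default ?s1.
  rewrite coef_poly ltnS n1 coef_XnD1_exp //= -mulrnA => /eqP.
  rewrite -(dvdn_pcharf pchark) Euclid_dvdM ?(pcharf_prime pchark) //.
  by rewrite gtnNdvd //= (dvdn_pcharf pchark) => ->.
by rewrite n1.
Qed.

(* When [4 b^2 = 1] the trinomial [X + b (X^2 + 1)] is [b (X + 2 b)^2]. *)
Lemma central_coef_degenerate n b : (2 * n < p)%N -> 4%:R * b ^+ 2 = 1 ->
  (central_coef n).[b] != 0.
Proof.
move=> np b4; rewrite -central_coefE -rmorphXn /= coef_comp_poly_Xn // dvdn_mulr //.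
rewrite mulKn //.
have b0 : b != 0.
  by apply: contra_eq_neq b4 => ->; rewrite expr0n mulr0 eq_sym oner_neq0.
have -> : middle_trinomial b = b%:P * ((2%:R * b)%:P + 'X) ^+ 2.
  have c4 : 4%:R * b%:P ^+ 2 = 1 :> {poly k}.
    by rewrite -polyC_exp -polyC_natr -polyCM b4.
  apply: subr0_eq; rewrite /middle_trinomial polyCM polyC_natr.
  transitivity ((1 - 4%:R * b%:P ^+ 2) * ('X + b%:P)); first by ring.
  by rewrite c4 subrr mul0r.
rewrite exprMn -exprM -polyC_exp coefCM mulf_neq0 ?expf_neq0 //.
rewrite exprDn coef_sum.
have lt_n : (n < (2 * n).+1)%N by lia.
rewrite (bigD1 (Ordinal lt_n)) //= big1 ?addr0 => [|i ne].
  rewrite coefMn -polyC_exp coefCM coefXn eqxx mulr1 -[X in X != 0]mulr_natr mulf_neq0 //.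
    apply/expf_neq0/mulf_neq0 => //; apply: contra_eq_neq b4 => k2.
    by rewrite [4%:R](natrM _ 2 2) k2 !mul0r eq_sym oner_neq0.
  by rewrite (natr_bin_neq0 pchark) // leq_pmull.
rewrite coefMn -polyC_exp coefCM coefXn.
by case: eqP => [ei|_]; [case/eqP: ne; apply: val_inj | rewrite mulr0 mul0rn].
Qed.

End PalindromicSextics.

(** * Forms with threshold [(p^2 - 1) / (3 p^2)] *)

Section PlaneCurve.
Variable k : closedFieldType.
(** Elements of [{poly {poly k}}] are functions on a plane: the inner variable is the parameter [s],
    the outer one is [l]. *)
Local Notation at_param s := (map_poly (horner_eval s)).
Implicit Types (s : k) (u : {poly k}) (c e q r : {poly {poly k}}).

(** The Nullstellensatz in one variable: [f] splits, and each of its linear factors is absorbed by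
    one copy of [g]. *)
Lemma dvdp_exp_of_roots (f g : {poly k}) : f != 0 ->
  (forall x, root f x -> root g x) -> f %| g ^+ (size f).
Proof.
move=> f0 sub; have [rs def_f] := closed_field_poly_normal f.
have : all (root g) rs.
  apply/allP => x xrs; apply: sub.
  by rewrite def_f rootZ ?lead_coef_eq0 // root_prod_XsubC.
have -> : size f = (size rs).+1.
  by rewrite def_f size_scale ?lead_coef_eq0 // size_prod_XsubC.
rewrite def_f dvdpZl ?lead_coef_eq0 // exprS => rs_g; apply: dvdp_mull.
elim: rs rs_g {def_f} => [|x rs IH] /=; first by rewrite big_nil dvd1p.
by case/andP=> gx /IH rs_g; rewrite big_cons exprS dvdp_mul // dvdp_XsubCl.
Qed.

Lemma at_param0_eq0 q : at_param 0 q = 0 -> exists q', q = 'X *: q'.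
Proof.
move=> q0; exists (\poly_(i < size q) (q`_i %/ 'X)).
apply/polyP => i; rewrite coefZ coef_poly.
case: ltnP => [_ | le_i]; last by rewrite nth_default // mulr0.
have : root q`_i 0 by rewrite rootE -[_.[0]]/(horner_eval 0 q`_i) -coef_map q0 coef0.
by rewrite -dvdp_XsubCl subr0 => /divpK {1}<-; rewrite mulrC.
Qed.

(* A factor depending only on the parameter can be cancelled before specializing the
   parameter to [0], even if it vanishes there. *)
Lemma dvdp_at_param0 u c e q : u != 0 -> at_param 0 c != 0 -> u *: e = q * c ->
  at_param 0 c %| at_param 0 e.
Proof.
move=> u0 c0; have [n] := ubnP (size u).
elim: n u u0 q => // n IH u u0 q lt_n eq_ue.
have eq0 : u.[0] *: at_param 0 e = at_param 0 q * at_param 0 c.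
  by rewrite -rmorphM -eq_ue /= map_polyZ.
have [ru | nru] := boolP (root u 0); last first.
  by rewrite -(dvdpZr _ _ (nru : u.[0] != 0)) eq0 dvdp_mull.
have /at_param0_eq0 [q' def_q] : at_param 0 q = 0.
  move/eqP: eq0; rewrite (rootP ru) scale0r eq_sym mulf_eq0 (negPf c0) orbF.
  by move/eqP.
have /factor_theorem [u'] := ru; rewrite subr0 => def_u.
have u'0 : u' != 0 by apply: contraNneq u0 => u'0; rewrite def_u u'0 mul0r.
apply: (IH u' u'0 q').
  by move: lt_n; rewrite def_u size_mulX.
have X0 : 'X%:P != 0 :> {poly {poly k}} by rewrite polyC_eq0 polyX_eq0.
apply: (mulfI X0); rewrite !mul_polyC scalerA mulrC -def_u eq_ue def_q.
by rewrite scalerAl.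
Qed.

(* If [c = 0] forced [e = 0] off the line [s = 0], then by the Nullstellensatz [c] would
   divide a power of [e] up to a factor in [s] alone; at [s = 0] this is impossible. *)
Lemma exists_curve_point c e :
  (1 < size (at_param 0 c))%N -> size (at_param 0 e) = 1%N ->
  exists s l : k, [/\ s != 0, (at_param s c).[l] = 0 & (at_param s e).[l] != 0].
Proof.
move=> c0 e0; apply: contrapT => nex.
have c0' : at_param 0 c != 0 by rewrite -size_poly_gt0 ltnW.
have cn0 : c != 0 by apply: contraNneq c0' => ->; rewrite rmorph0.
pose E := e ^+ (size c).
have rem0 : E %% c = 0.
  apply/polyP => i; rewrite coef0; apply/eqP; apply: contraT => ri.
  (* Pick [s] nonzero where neither this coefficient nor the leading coefficient of [c] vanishes:
     pseudo-division then specializes well, and [c] divides a nonzero remainder of smaller size. *)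
  have : (E %% c)`_i * ('X * lead_coef c) != 0.
    by rewrite !mulf_neq0 ?polyX_eq0 ?lead_coef_eq0.
  case/closed_nonrootP => s; rewrite rootE !hornerM hornerX !mulf_eq0 !negb_or.
  case/and3P => rs s0 ls.
  have sc : size (at_param s c) = size c by rewrite size_map_poly_id0.
  have cs0 : at_param s c != 0 by rewrite -size_poly_gt0 sc size_poly_gt0.
  have dv : at_param s c %| at_param s E.
    rewrite rmorphXn /= -sc; apply: dvdp_exp_of_roots => // l cl.
    apply: contraT => el; case: nex; exists s, l; split=> //; exact/eqP.
  have := congr1 (at_param s) (Pdiv.Idomain.divp_eq E c).
  rewrite rmorphD rmorphM /= map_polyZ => eqE.
  have : at_param s c %| at_param s (E %% c).
    rewrite -(dvdp_addr _ (dvdp_mull (at_param s (E %/ c)) (dvdpp _))) -eqE.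
    by rewrite dvdpZr // rmorphXn /= expf_neq0.
  have lt_r : (size (at_param s (E %% c)%R) < size (at_param s c))%N.
    by rewrite sc (leq_ltn_trans (size_poly _ _)) // ltn_modpN0.
  case: (eqVneq (at_param s (E %% c)) 0) => [r0 _|r0 /(dvdp_leq r0)]; last first.
    by rewrite leqNgt lt_r.
  by move: rs; rewrite -[_.[s]]/(horner_eval s _) -coef_map r0 coef0 eqxx.
have := Pdiv.Idomain.divp_eq E c; rewrite rem0 addr0 => eqE.
have l0 : lead_coef c ^+ scalp E c != 0 by rewrite expf_neq0 // lead_coef_eq0.
have := dvdp_at_param0 l0 c0' eqE; rewrite rmorphXn /=.
have [a a0 ->] := size_poly1P _ (introT eqP e0).
move/dvdp_leq; rewrite -polyC_exp polyC_eq0 expf_neq0 // => /(_ isT).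
by rewrite size_polyC expf_neq0 // leqNgt c0.
Qed.

End PlaneCurve.

(** * First-order expansion of powers of a deformed Fermat cubic *)

Section DeformedFermatCubic.
Variable T : comNzRingType.
Implicit Types (s l : T) (n i j : nat).

Lemma exprD_first_order (A : comNzRingType) (a b s : A) n :
  exists w, (a + s * b) ^+ n.+1 = a ^+ n.+1 + s * (n.+1%:R * b * a ^+ n) + s ^+ 2 * w.
Proof.
elim: n => [|n [w IH]]; first by exists 0; rewrite !expr1 expr0; ring.
exists (n.+1%:R * b ^+ 2 * a ^+ n + (a + s * b) * w).
by rewrite exprS IH -[n.+2%:R]natr1 !(exprS a); ring.
Qed.

Definition deformed_cubic s l : {poly T} := 'X^3 + 1 + s%:P * ('X^2 + l%:P * 'X).

Lemma coef_deformed_cubic_exp s l n i : exists w,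
  (deformed_cubic s l ^+ n.+1)`_i =
    (('X^3 + 1) ^+ n.+1)`_i +
    s * (n.+1%:R * (('X^2 * ('X^3 + 1) ^+ n)`_i + l * ('X * ('X^3 + 1) ^+ n)`_i) + s * w).
Proof.
have [w def_w] := exprD_first_order ('X^3 + 1) ('X^2 + l%:P * 'X) s%:P n.
exists w`_i; rewrite def_w -polyC_exp !coefD !coefCM.
rewrite -[n.+1%:R * _ * _]mulrA -polyC_natr coefCM mulrDl coefD.
rewrite -[l%:P * _ * _]mulrA coefCM.
by ring.
Qed.

(** Powers of [X^3 + 1] only have exponents divisible by [3], so in degrees [2] modulo [3] the
    constant term in [s] vanishes and only the summand [X^2] counts to first order. *)
Lemma coef_deformed_cubic_exp2 s l n j : exists w,
  (deformed_cubic s l ^+ n.+1)`_(3 * j + 2) = s * ((n.+1 * 'C(n, j))%:R + s * w).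
Proof.
have [w ->] := coef_deformed_cubic_exp s l n (3 * j + 2); exists w.
rewrite coefXnM coefXM addnK !coef_XnD1_exp // [(3 * j + 2 < 2)%N]ltnNge leq_addl /=.
have -> : (3 %| 3 * j + 2)%N = false by apply/negP => /dvdnP[a]; lia.
have -> : (3 * j + 2 == 0)%N = false by lia.
have -> : (3 %| (3 * j + 2).-1)%N = false by apply/negP => /dvdnP[a]; lia.
by rewrite dvdn_mulr // mulKn // natrM /=; ring.
Qed.

Lemma coef_deformed_cubic_exp1 s l n j : exists w,
  (deformed_cubic s l ^+ n.+1)`_(3 * j + 1) = s * (l * (n.+1 * 'C(n, j))%:R + s * w).
Proof.
have [w ->] := coef_deformed_cubic_exp s l n (3 * j + 1); exists w.
rewrite coefXnM coefXM addn1 /= !coef_XnD1_exp //.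
have -> : (3 %| (3 * j).+1)%N = false by apply/negP => /dvdnP[a]; lia.
rewrite dvdn_mulr // mulKn // natrM; case: ltnP => [_|le_j]; first by ring.
have -> : (3 %| (3 * j).+1 - 2)%N = false by apply/negP => /dvdnP[a]; lia.
by ring.
Qed.

Lemma size_deformed_cubic s l : size (deformed_cubic s l) = 4%N.
Proof.
rewrite size_polyDl size_XnaddC // ltnS.
apply/leq_sizeP => i le_i; rewrite coefCM coefD coefXn coefCM coefX.
have -> : (i == 2)%N = false by lia.
have -> : (i == 1)%N = false by lia.
by rewrite /= !(mulr0, addr0).
Qed.

End DeformedFermatCubic.

Lemma map_deformed_cubic (S T : comNzRingType) (g : {rmorphism S -> T}) (s l : S) :
  map_poly g (deformed_cubic s l) = deformed_cubic (g s) (g l).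
Proof.
rewrite /deformed_cubic.
by rewrite !(rmorph1, rmorphD, rmorphXn, rmorphM) /= !map_polyX !map_polyC.
Qed.

(* With [p = 6 h + 5] one has [(p^2 - 1) / 3 = (2 h + 1) p + (4 h + 3)]; for degree reasons
   only two coefficients of the [p]-th power contribute to the middle coefficient. *)
Lemma middle_coef_deformed_cubic (T : comNzRingType) (p h : nat) (s l : T) :
  p \in [pchar T] -> (p = 6 * h + 5)%N ->
  let F := deformed_cubic s l in
  (F ^+ ((2 * h).+1 * p + (4 * h + 2).+1))`_(p * (3 * h + 2) + (3 * h + 2)) =
    (F ^+ (2 * h).+1)`_(3 * h + 2) ^+ p * (F ^+ (4 * h + 2).+1)`_(3 * h + 2) +
    (F ^+ (2 * h).+1)`_(3 * h + 1) ^+ p * (F ^+ (4 * h + 2).+1)`_(3 * (3 * h + 2) + 1).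
Proof.
move=> pcharT def_p F.
have sX n : (size (F ^+ n) <= (3 * n).+1)%N.
  by apply: size_exp_bound; rewrite size_deformed_cubic.
have := coef_frobM pcharT 1 (F ^+ (4 * h + 2).+1)
  (p * (3 * h + 2) + (3 * h + 2)) (sX (2 * h).+1).
rewrite expn1 -exprM -exprD => ->.
have lt2 : (3 * h + 2 < (3 * (2 * h).+1).+1)%N by lia.
have lt1 : (3 * h + 1 < (3 * (2 * h).+1).+1)%N by lia.
rewrite (bigD1 (Ordinal lt2)) /= ?leq_addr // addKn; congr (_ + _).
have ne : Ordinal lt1 != Ordinal lt2 by apply/eqP => /(congr1 val) /=; lia.
rewrite (bigD1 (Ordinal lt1)) /=; last by rewrite ne andbT; nia.
rewrite big1 ?addr0 => [|i /andP[/andP[le_i ne2] ne1]].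
  by congr (_ * _`_ _); rewrite def_p; lia.
rewrite [X in _ * X]nth_default ?mulr0 // (leq_trans (sX _)) //.
have : (i : nat) != (3 * h + 2)%N by apply: contraNneq ne2 => ei; apply/eqP/val_inj.
have : (i : nat) != (3 * h + 1)%N by apply: contraNneq ne1 => ei; apply/eqP/val_inj.
move: (i : nat) le_i => j le_i n1 n2; have : (j <= 3 * h)%N by nia.
by move=> le_j; nia.
Qed.

Section Sextics.
Variables (k : closedFieldType) (p : nat).
Hypothesis pchark : p \in [pchar k].
Implicit Types (phi F : {poly k}).

Lemma simple_roots_comp_X2 F : p != 2%N -> F.[0] != 0 -> simple_roots F ->
  simple_roots (F \Po 'X^2).
Proof.
move=> p2 F0 simp t; rewrite !rootE deriv_comp hornerM !horner_comp hornerXn => rt.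
have k2 : 2%:R != 0 :> k by rewrite (natr_prime_neq0 pchark).
have t0 : t != 0 by apply: contraTneq rt => ->; rewrite expr0n.
rewrite mulf_neq0 //; first exact: simp.
by rewrite derivXn hornerMn hornerXn expr1 -mulr_natr mulf_neq0.
Qed.

(* Minus the discriminant of [X^3 + s X^2 + t X + 1]. *)
Definition cubic_disc (T : comNzRingType) (s t : T) : T :=
  27%:R - 18%:R * s * t - s ^+ 2 * t ^+ 2 + 4%:R * s ^+ 3 + 4%:R * t ^+ 3.

Lemma deformed_cubic_simple (s l : k) : p != 3%N -> cubic_disc s (l * s) != 0 ->
  simple_roots (deformed_cubic s l).
Proof.
move=> p3 D0 u; rewrite !rootE => /eqP Fu; apply: contraNneq D0 => dFu.
have k3 : 3%:R != 0 :> k by rewrite (natr_prime_neq0 pchark).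
have {}Fu : u ^+ 3 + 1 + s * (u ^+ 2 + l * u) = 0.
  by rewrite -[RHS]Fu !(hornerXn, hornerX, hornerC, hornerM, hornerD).
have {}dFu : 3%:R * u ^+ 2 + s * (2%:R * u + l) = 0.
  rewrite -[RHS]dFu !(derivXn, derivX, derivC, derivM, derivD).
  rewrite !(hornerMn, hornerXn, hornerX, hornerC, hornerM, hornerD) /= expr1.
  by ring.
suff /eqP : 3%:R * 3%:R * cubic_disc s (l * s) = 0.
  by rewrite !mulf_eq0 (negPf k3).
(* [a * u + b] is the value at [u] of the remainder of nine times the cubic by its derivative;
   eliminating [u] between it and the derivative leaves the discriminant up to a constant. *)
pose a := 6%:R * (l * s) - 2%:R * s ^+ 2; pose b := 9%:R - s * (l * s).
transitivity (a ^+ 2 * (3%:R * u ^+ 2 + s * (2%:R * u + l))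
  - (9%:R * (u ^+ 3 + 1 + s * (u ^+ 2 + l * u))
     - (3%:R * u + s) * (3%:R * u ^+ 2 + s * (2%:R * u + l)))
    * (3%:R * a * u + 2%:R * s * a - 3%:R * b)).
  by rewrite /cubic_disc /a /b; ring.
by rewrite Fu dFu; ring.
Qed.

Lemma coef_comp_X2_exp F n i j : (j = 2 * i)%N ->
  ((F \Po 'X^2) ^+ n)`_j = (F ^+ n)`_i.
Proof.
by move=> ->; rewrite -rmorphXn /= coef_comp_poly_Xn // dvdn_mulr // mulKn.
Qed.

(* On [s = 0] the cubic is [X^3 + 1], i.e. the form is [x^6 + y^6], for which all three
   coefficients deciding membership of [f^(2h+1)] in [(x^p, y^p)] vanish.  Blowing up this
   point of the plane of forms [x^6 + s x^4 y^2 + t x^2 y^4 + y^6] by [t = l s], the middle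
   coefficient becomes [s^(p+1)] times a function restricting to a nonzero multiple of
   [l^(p+1) + 1] on [s = 0], while the relevant coefficient of [f^(2h+1)] becomes [s] times
   a function restricting to a nonzero constant. *)
Lemma exists_middle_sextic h (m := ((2 * h).+1 * p + (4 * h + 2).+1)%N) :
  (p = 6 * h + 5)%N -> exists phi,
  [/\ simple_roots phi, size phi = 7%N,
      ~ frob_ideal (6 * (2 * h).+1) p (phi ^+ (2 * h).+1) & (phi ^+ m)`_(3 * m) = 0].
Proof.
move=> def_p; have p_pr := pcharf_prime pchark.
have pcharT : p \in [pchar {poly {poly k}}] by rewrite !pchar_poly.
pose s : {poly {poly k}} := 'X%:P; pose l : {poly {poly k}} := 'X.
pose al := ((2 * h).+1 * 'C(2 * h, h))%N.
pose be := ((4 * h + 2).+1 * 'C(4 * h + 2, h))%N.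
have al0 : al%:R != 0 :> k.
  rewrite natrM mulf_neq0 ?(natr_bin_neq0 pchark) //; last by lia.
  by rewrite -(dvdn_pcharf pchark) gtnNdvd //; lia.
have be0 : be%:R != 0 :> k.
  rewrite natrM mulf_neq0 ?(natr_bin_neq0 pchark) //; last by lia.
  by rewrite -(dvdn_pcharf pchark) gtnNdvd //; lia.
have [w1 E1] := coef_deformed_cubic_exp2 s l (2 * h) h.
have [w2 E2] := coef_deformed_cubic_exp1 s l (2 * h) h.
have [w3 E3] := coef_deformed_cubic_exp2 s l (4 * h + 2) h.
have [w4 E4] := coef_deformed_cubic_exp1 s l (4 * h + 2) (3 * h + 2).
have binE : 'C(4 * h + 2, 3 * h + 2) = 'C(4 * h + 2, h).
  by rewrite -bin_sub; [congr binomial; lia | lia].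
rewrite binE in E4; rewrite -/al in E1 E2; rewrite -/be in E3 E4.
clearbody al be.
(* [c] is the middle coefficient divided by [s ^+ p.+1]. In [e], the factor [A] guards nonmembership
   of the lower power and the discriminant guards simple roots. *)
pose A : {poly {poly k}} := al%:R + s * w1.
pose c : {poly {poly k}} :=
  A ^+ p * (be%:R + s * w3) + (l * al%:R + s * w2) ^+ p * (l * be%:R + s * w4).
pose e : {poly {poly k}} := A * cubic_disc s (l * s).
have s0E : map_poly (horner_eval (0 : k)) s = 0.
  by rewrite map_polyC /= /horner_eval hornerX polyC0.
have lE : map_poly (horner_eval (0 : k)) l = 'X by rewrite map_polyX.
have c0 : (1 < size (map_poly (horner_eval (0 : k)) c))%N.
  have -> : map_poly (horner_eval (0 : k)) c = (al%:R ^+ p * be%:R)%:P * ('X^(p.+1) + 1).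
    rewrite /c /A !(rmorph_nat, rmorphD, rmorphXn, rmorphM) /= s0E lE.
    by rewrite !mul0r !addr0 !exprMn exprS; ring.
  by rewrite size_Cmul ?size_XnaddC // mulf_neq0 // expf_neq0.
have e0 : size (map_poly (horner_eval (0 : k)) e) = 1%N.
  have -> : map_poly (horner_eval (0 : k)) e = (al%:R * 27%:R)%:P.
    rewrite /e /A /cubic_disc !(rmorph_nat, rmorphB, rmorphD, rmorphXn, rmorphM) /= s0E lE.
    by rewrite mul0r addr0; ring.
  have -> : 27%:R = 3%:R ^+ 3 :> k by rewrite -natrX.
  by rewrite size_polyC mulf_neq0 // expf_neq0 // (natr_prime_neq0 pchark) //; lia.
have [s0 [l0 [s0_neq0 cE eE]]] := exists_curve_point c0 e0.
pose ev : {rmorphism {poly {poly k}} -> k} := horner_eval l0 \o map_poly (horner_eval s0).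
have evs : ev s = s0 by rewrite /ev /= map_polyC /= /horner_eval hornerX hornerC.
have evl : ev l = l0 by rewrite /ev /= map_polyX /horner_eval hornerX.
have {}cE : ev c = 0 by [].
have {eE} : ev e != 0 by [].
rewrite rmorphM mulf_eq0 negb_or => /andP[A0 D0].
pose F := deformed_cubic s0 l0.
have FE n i : (F ^+ n)`_i = ev (deformed_cubic s l ^+ n)`_i.
  by rewrite -coef_map rmorphXn /= map_deformed_cubic evs evl.
exists (F \Po 'X^2); split.
- apply: simple_roots_comp_X2; first by lia.
    rewrite !(hornerXn, hornerX, hornerC, hornerM, hornerD).
    by rewrite !expr0n /= !mulr0 !addr0 mulr0 add0r addr0 oner_neq0.
  apply: deformed_cubic_simple; first by lia.
  move: D0; rewrite /cubic_disc.
  by rewrite !(rmorph_nat, rmorphB, rmorphD, rmorphXn, rmorphM) evs evl.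
- have := size_comp_poly F 'X^2; rewrite size_deformed_cubic size_polyXn.
  by case: (size _) => //= n ->.
- move=> /(_ p.-1); rewrite (coef_comp_X2_exp _ _ (i := 3 * h + 2)); last by lia.
  rewrite FE E1 rmorphM evs => I; have : s0 * ev A != 0 by rewrite mulf_neq0.
  by rewrite I ?eqxx //; lia.
rewrite (coef_comp_X2_exp _ _ (i := p * (3 * h + 2) + (3 * h + 2))); last by rewrite /m; nia.
rewrite FE (middle_coef_deformed_cubic _ _ pcharT def_p) E1 E2 E3 E4.
rewrite -/A; transitivity (ev (s ^+ p.+1 * c)).
  by congr (ev _); rewrite /c !exprMn exprS; ring.
by rewrite rmorphM cE mulr0.
Qed.

End Sextics.

Section SexticExamples.
Variables (R : realType) (k : closedFieldType) (p : nat).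
Hypothesis pchark : p \in [pchar k].

Lemma fpt_values_sextic (v : R) :
  fpt_values k R p 6 v <-> exists phi : {poly k},
    [/\ simple_roots phi, (6 <= size phi <= 7)%N & fpt R p (homogenize 6 phi) = v].
Proof.
split=> [[f redf <-] | [phi [simp sphi <-]]].
  have [simp sphi] := reduced_form_dehom (isT : 1 < 6)%N redf.
  by exists (dehom k f); case: redf => _ hf _; rewrite dehomK.
by exists (homogenize 6 phi) => //; apply: reduced_form_homogenize.
Qed.

Lemma simple_roots_XnD1 n : (p %| n)%N = false -> simple_roots ('X^n + 1 : {poly k}).
Proof.
move=> pn t; rewrite !rootE derivD derivXn derivC addr0 hornerD hornerXn hornerC => rt.
rewrite hornerMn hornerXn -mulr_natr mulf_neq0 -?(dvdn_pcharf pchark) ?pn //.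
case: n pn rt => [|n] /= pn rt; first by rewrite expr0 oner_neq0.
apply: contraTneq rt => tn; rewrite exprS tn mulr0 add0r oner_neq0 //.
Qed.

(** In characteristics [2] and [3] the derivative is the constant [1]. *)
Lemma simple_roots_X6DX : (p %| 6)%N -> simple_roots ('X^6 + 'X : {poly k}).
Proof.
move=> p6 t _; rewrite rootE derivD derivXn derivX -mulr_natr.
have -> : 6%:R = 0 :> {poly k}.
  by rewrite -polyC_natr; move: p6; rewrite (dvdn_pcharf pchark) => /eqP ->.
by rewrite mulr0 add0r hornerC oner_neq0.
Qed.

Lemma size_X6DX : size ('X^6 + 'X : {poly k}) = 7%N.
Proof. by rewrite size_polyDl size_polyXn // size_polyX. Qed.

Lemma size_X6D1 : size ('X^6 + 1 : {poly k}) = 7%N.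
Proof. by rewrite size_XnaddC. Qed.

Lemma exists_palindromic_sextic n : p != 3%N -> exists phi : {poly k},
  [/\ simple_roots phi, size phi = 7%N & (phi ^+ n)`_(3 * n) != 0].
Proof.
move=> p3.
(* A non-root [b] of this product avoids both the bad and the non-reduced parameters. *)
have : central_coef k n * ('X * (4%:R * 'X^2 - 1)) != 0.
  rewrite !mulf_neq0 ?central_coef_neq0 ?polyX_eq0 //.
  apply: contra_neq (oner_neq0 k) => /(congr1 (fun g : {poly k} => - g`_0)).
  by rewrite coefB coef1 -polyC_natr coefCM coefXn mulr0 sub0r opprK coef0 oppr0.
case/closed_nonrootP => b; rewrite rootE !hornerM hornerX !mulf_eq0 !negb_or.
case/and3P => cb b0; rewrite hornerD hornerN hornerC hornerM -polyC_natr hornerC.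
rewrite hornerXn subr_eq0 => b4.
exists (palindromic_sextic b); split; last by rewrite central_coefE.
  exact: (palindromic_sextic_simple pchark).
exact: size_palindromic_sextic.
Qed.

Lemma exists_palindromic_sextic0 n : (1 < n)%N -> p = (3 * n + 1)%N ->
  exists phi : {poly k},
    [/\ simple_roots phi, size phi = 7%N & (phi ^+ n)`_(3 * n) = 0].
Proof.
move=> n1 def_p.
have /closed_rootP [b rb] : size (central_coef k n) != 1%N.
  by apply: (central_coef_nonconst pchark); lia.
have b0 : b != 0.
  apply: contraTneq rb => ->; rewrite rootE horner_coef0 coef_poly expr0 coef1 bin0.
  by rewrite oner_neq0.
have b4 : 4%:R * b ^+ 2 != 1.
  by apply: contraTneq rb => b4; apply: (central_coef_degenerate pchark) => //; lia.
exists (palindromic_sextic b); split; last by rewrite central_coefE; apply/eqP.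
  by apply: (palindromic_sextic_simple pchark) => //; lia.
exact: size_palindromic_sextic.
Qed.

End SexticExamples.

(** * The values in degree 6 *)

Section SexticValues.
Variables (R : realType) (k : closedFieldType) (p : nat).
Hypothesis pchark : p \in [pchar k].

Lemma fpt_values_char3 : p = 3%N -> fpt_values k R p 6 = [set 1 / 3%:R]%classic.
Proof.
move=> p3; apply/seteqP; split=> [v /fpt_values_sextic|v ->].
  by move=> [phi [simp sphi <-]]; apply: (fpt_char3 _ pchark).
have simp : simple_roots ('X^6 + 'X : {poly k}).
  by apply: (simple_roots_X6DX pchark); rewrite p3.
apply/fpt_values_sextic; exists ('X^6 + 'X); rewrite size_X6DX; split=> //.
by apply: (fpt_char3 _ pchark); rewrite ?size_X6DX.
Qed.

Lemma fpt_values_char2 :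
  p = 2%N -> fpt_values k R p 6 = [set 1 / 3%:R; 1 / 4%:R]%classic.
Proof.
move=> p2; apply/seteqP; split=> [v /fpt_values_sextic|v].
  move=> [phi [simp sphi <-]]; rewrite (fpt_char2 _ pchark) //.
  by case: ifP => _; [right | left].
case=> ->; apply/fpt_values_sextic.
  have [|phi [simp sphi]] := exists_palindromic_sextic pchark 1; first by rewrite p2.
  rewrite expr1 => c3; exists phi; rewrite sphi; split=> //.
  by rewrite (fpt_char2 _ pchark) ?sphi // (negPf c3).
have simp : simple_roots ('X^6 + 'X : {poly k}).
  by apply: (simple_roots_X6DX pchark); rewrite p2.
exists ('X^6 + 'X); rewrite size_X6DX; split=> //.
by rewrite (fpt_char2 _ pchark) ?size_X6DX // coefD coefXn coefX addr0 eqxx.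
Qed.

Lemma fpt_values_mod1 : p = 1%N %[mod 3] ->
  fpt_values k R p 6 = [set 1 / 3%:R; (p%:R - 1) / (3%:R * p%:R)]%classic.
Proof.
move=> p1; have p_gt1 := prime_gt1 (pcharf_prime pchark).
pose n := (p %/ 3)%N.
have def_p : (p = 3 * n + 1)%N by rewrite /n; lia.
have n1 : (1 < n)%N.
  have := pcharf_prime pchark; rewrite def_p.
  by case: n def_p => [|[|n]] // ?; lia.
apply/seteqP; split=> [v /fpt_values_sextic|v].
  move=> [phi [simp sphi <-]]; rewrite (fpt_mod1 _ pchark simp sphi def_p).
  by case: ifP => _; [right | left].
case=> ->; apply/fpt_values_sextic.
  have [|phi [simp sphi c0]] := exists_palindromic_sextic pchark n; first by lia.
  exists phi; rewrite sphi; split=> //.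
  by rewrite (fpt_mod1 _ pchark simp _ def_p) ?sphi // (negPf c0).
have [phi [simp sphi c0]] := exists_palindromic_sextic0 pchark n1 def_p.
exists phi; rewrite sphi; split=> //.
by rewrite (fpt_mod1 _ pchark simp _ def_p) ?sphi // c0 eqxx.
Qed.

Lemma fpt_values_mod2 : p = 2%N %[mod 3] -> (5 <= p)%N ->
  fpt_values k R p 6 =
    [set 1 / 3%:R; (p%:R - 2%:R) / (3%:R * p%:R);
         (p%:R ^+ 2 - 1) / (3%:R * p%:R ^+ 2)]%classic.
Proof.
move=> p2 p5; have p_pr := pcharf_prime pchark.
have p_odd : odd p by case: (even_prime p_pr) => // p_eq2; lia.
pose h := (p %/ 6)%N.
have def_p : (p = 6 * h + 5)%N by rewrite /h; lia.
pose n := (2 * h).+1; pose m := ((2 * h).+1 * p + (4 * h + 2).+1)%N.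
have def_n : (p = 3 * n + 2)%N by rewrite /n; lia.
have def_m : (3 * m + 1 = p ^ 2)%N by rewrite /m -mulnn {1 2}def_p; nia.
apply/seteqP; split=> [v /fpt_values_sextic|v].
  move=> [phi [simp sphi <-]].
  have [I|nI] := pselect (frob_ideal (6 * n) p (phi ^+ n)).
    by left; right; apply: (fpt_mod2_low _ pchark simp sphi _ def_n I).
  have [c0|c0] := eqVneq (phi ^+ m)`_(3 * m) 0.
    by right; apply: (fpt_mod2_middle _ pchark simp sphi _ def_n def_m nI c0).
  by left; left; apply: (fpt_mod2_top _ pchark sphi def_m c0).
case=> [[->|->]|->]; apply/fpt_values_sextic.
- have [|phi [simp sphi c0]] := exists_palindromic_sextic pchark m; first by lia.
  exists phi; rewrite sphi; split=> //.
  by apply: (fpt_mod2_top _ pchark _ def_m c0); rewrite sphi.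
- have simp : simple_roots ('X^6 + 1 : {poly k}).
    apply: (simple_roots_XnD1 pchark); rewrite (Euclid_dvdM 2 3 p_pr).
    by rewrite !gtnNdvd //; lia.
  exists ('X^6 + 1); rewrite size_X6D1; split=> //.
  apply: (fpt_mod2_low _ pchark simp _ _ def_n) => //; first by rewrite size_X6D1.
  (* The tested indices are [p - 3], [p - 2] and [p - 1], congruent to [2], [3], [4] modulo [6],
     while only multiples of [6] occur. *)
  move=> i ip ni; rewrite coef_XnD1_exp //; case: ifP => // /dvdnP [j def_i].
  by rewrite /n in ni; lia.
have [phi [simp sphi nI c0]] := exists_middle_sextic pchark def_p.
exists phi; rewrite sphi; split=> //.
by apply: (fpt_mod2_middle _ pchark simp _ _ def_n def_m nI c0); rewrite ?sphi.
Qed.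

End SexticValues.

Local Open Scope classical_set_scope.

Theorem proposition7p7 (R : realType) (k : closedFieldType) (p : nat)
    (hp : p \in [pchar k]) :
  [/\ (* (a) *)
      p = 3%N ->
        fpt_values k R p 6 = [set 1 / 3%:R],
      (* (b) *)
      p = 1%N %[mod 3] ->
        fpt_values k R p 6 =
          [set 1 / 3%:R; (p%:R - 1) / (3%:R * p%:R)]
    & (* (c) *)
      p = 2%N %[mod 3] ->
        ((5 <= p)%N ->
          fpt_values k R p 6 =
            [set 1 / 3%:R; (p%:R - 2%:R) / (3%:R * p%:R);
                 (p%:R ^+ 2 - 1) / (3%:R * p%:R ^+ 2)]) /\
        (p = 2%N ->
          fpt_values k R p 6 = [set 1 / 3%:R; 1 / 4%:R])].
Proof.
split=> [p3 | p1 | p2]; first exact: fpt_values_char3.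
  exact: fpt_values_mod1.
by split=> [p5 | p2']; [apply: fpt_values_mod2 | apply: fpt_values_char2].
Qed.
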